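(* Let $G=(V,E,w)$ be an $n$-vertex weighted graph which is $(t,\delta)$-strongly-decomposable, and let $\Lambda=\frac{\max_{e\in E}w(e)}{\min_{e\in E}w(e)}$ be its aspect ratio. Then for every $\epsilon\in(0,1)$ there is a $t\cdot(2+\epsilon)$-graph-spanner of $G$ with lightness $O_\epsilon\!\left(\frac{t}{\delta}\cdot\log^2 n\right)$ and with $O_\epsilon\!\left(\frac{n}{\delta}\cdot\log n\cdot\log\Lambda\right)$ edges.
   Context: $G$ has positive edge weights and shortest-path metric $d_G$. For $A\subseteq V$, the strong diameter of $A$ is $\max_{u,v\in A}d_{G[A]}(u,v)$, where $G[A]$ is the induced subgraph on $A$. $G$ is $(t,\delta)$-strongly-decomposable if for every $\Delta>0$ there is a probability distribution over partitions of $V$ such that every partition in the support has all clusters of strong diameter at most $t\cdot\Delta$, and every two vertices $u,v$ with $d_G(u,v)\le\Delta$ lie in the same cluster with probability at least $\delta$. A $k$-graph-spanner of $G$ is a subgraph $H$ of $G$ on vertex set $V$ (same edge weights) with $d_H(u,v)\le k\cdot d_G(u,v)$ for all $u,v\in V$; its lightness is its total weight divided by the weight of a minimum spanning tree of $G$. $O_\epsilon(f)$ means $O(f)\cdot\mathrm{poly}(1/\epsilon)$; logarithms are base 2.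
   Formalization: In the bound on the number of edges, log Λ is replaced by max(1, log Λ), because with Λ = 1 (an unweighted connected graph on at least two vertices) the stated bound would allow no edges at all. *)

(* Defs.v *)
(* MathComp / MathComp-Analysis *)
From mathcomp Require Import all_boot all_order all_algebra.
From mathcomp Require Import classical_sets reals constructive_ereal ereal exp.

Set Implicit Arguments.
Unset Strict Implicit.
Unset Printing Implicit Defensive.

Import Order.TTheory GRing.Theory Num.Theory.
Local Open Scope ring_scope.

(* Finite simple undirected graphs on the vertex set V: an edge is a
   two-element set of vertices.  The value of wt outside edges is irrelevant. *)
Record wgraph (R : realType) (V : finType) := WGraph {
  edges : {set {set V}};
  wt : {set V} -> R;
  card_edge : forall e, e \in edges -> #|e| = 2%N;
  wt_gt0 : forall e, e \in edges -> 0 < wt e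
}.

Section Graphs.
Variables (R : realType) (V : finType).
Implicit Types (G H T : wgraph R V) (A : {set V}) (u v : V).

Definition adj G : rel V := fun u v => [set u; v]%SET \in edges G.

Definition weight G : R := \sum_(e in edges G) wt G e.

(* weight of the walk u :: p *)
Definition walk_weight G u (p : seq V) : R :=
  \sum_(x <- pairmap (fun a b => wt G [set a; b]%SET) u p) x.

(* Shortest-path distance, +oo between distinct components.  Since weights are
   positive, allowing walks does not change the infimum, which is attained
   whenever it is finite. *)
Definition dist G u v : \bar R :=
  ereal_inf [set (walk_weight G u p)%:E | p in
               [set p : seq V | path (adj G) u p /\ last u p = v]]%classic.

Definition graph_connected G : Prop := forall u v, connect (adj G) u v.

(* H is a subgraph on the whole vertex set V, with the weights of G *)
Definition subgraph H G : Prop :=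
  edges H \subset edges G /\ {in edges H, wt H =1 wt G}.

Section Induced.
Variables (G : wgraph R V) (A : {set V}).

Definition induced_edges : {set {set V}} :=
  [set e in edges G | e \subset A]%SET.

Lemma induced_card_edge e : e \in induced_edges -> #|e| = 2%N.
Proof. by rewrite inE => /andP[/card_edge]. Qed.

Lemma induced_wt_gt0 e : e \in induced_edges -> 0 < wt G e.
Proof. by rewrite inE => /andP[/wt_gt0]. Qed.

(* G[A]; vertices outside A are kept as isolated vertices, which does not
   affect distances between vertices of A *)
Definition induced : wgraph R V := WGraph induced_card_edge induced_wt_gt0.

End Induced.

(* The base value 0 is harmless, distances being nonnegative. *)
Definition strong_diam G A : \bar R :=
  \big[Order.max/0%E]_(u in A) \big[Order.max/0%E]_(v in A)
    dist (induced G A) u v.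

(* D P is the probability of the partition P of V *)
Definition partition_distr (D : {set {set V}} -> R) : Prop :=
  [/\ forall P, 0 <= D P,
      \sum_P D P = 1
    & forall P, D P != 0 -> finset.partition P [set: V]%SET].

Definition strongly_decomposable (t delta : R) G : Prop :=
  forall Delta : R, 0 < Delta ->
  exists D : {set {set V}} -> R,
    [/\ partition_distr D,
        forall P A, D P != 0 -> A \in P -> (strong_diam G A <= (t * Delta)%:E)%E
      & forall u v, (dist G u v <= Delta%:E)%E ->
          delta <= \sum_(P | v \in finset.pblock P u) D P].

Definition graph_spanner (k : R) G H : Prop :=
  subgraph H G /\ forall u v, (dist H u v <= k%:E * dist G u v)%E.

(* In a simple graph a closed walk a, b, a is a ucycle of size 2. *)
Definition acyclic G : Prop :=
  forall c : seq V, ucycle (adj G) c -> (size c <= 2)%N.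

Definition spanning_tree G T : Prop :=
  [/\ subgraph T G, graph_connected T & acyclic T].

(* Only finitely many values occur, so for connected G this is a minimum. *)
Definition mst_weight G : R :=
  inf [set weight T | T in [set T | spanning_tree G T]]%classic.

Definition lightness G H : R := weight H / mst_weight G.

Definition max_wt G : R := \big[Num.max/0]_(e in edges G) wt G e.
Definition min_wt G : R := \big[Num.min/max_wt G]_(e in edges G) wt G e.
Definition aspect_ratio G : R := max_wt G / min_wt G.

End Graphs.

Definition log2 (R : realType) (x : R) : R := ln x / ln 2.

(* Main.v *)
(** Process only the scales [D i = min_wt G * (1 + e) ^+ i], with [e = eps / 12].
    For each scale take an [e * D i]-net and [O(log n / delta)] partitions, chosen
    greedily, which together put every two net points at distance at most
    [(1 + 3 * e) * D i] into a common cluster.  In every cluster keep the part of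
    a shortest-path tree that joins the net points to a centre.

    Stretch: an edge [u v] of length [w] at scale [i] is replaced by
    [u ~> u' ~> v' ~> v] with [u'], [v'] net points; the middle part goes through
    a centre and costs [2 t (1 + 3 e) w], the other two are shorter than [w] and
    are handled by induction.

    Lightness: a net is separated, hence by a tour of any spanning tree it has
    [O(M / (e * D i))] points, [M] being the weight of a minimum spanning tree, so
    that one scale weighs [O(t M log n / (e * delta))].  Scales below [M / n] sum
    geometrically, scales above [2 M] contain no distance, and [O(log n / e)]
    scales remain. *)
Require Import Defs.
From mathcomp Require Import all_boot all_order all_algebra.
From mathcomp Require Import boolp classical_sets reals constructive_ereal ereal
  sequences exp.
From mathcomp Require Import ring lra.

Set Implicit Arguments.
Unset Strict Implicit.
Unset Printing Implicit Defensive.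

Import Order.TTheory GRing.Theory Num.Theory.
Local Open Scope ring_scope.

(** * Walks and distances *)

Section Walks.
Variables (R : realType) (V : finType).
Implicit Types (G H : wgraph R V) (u v x : V) (p : seq V) (r s : R).

Lemma adj_sym G : symmetric (adj G).
Proof. by move=> u v; rewrite /adj finset.setUC. Qed.

Lemma adj_neq G u v : adj G u v -> u != v.
Proof. by move=> /card_edge; rewrite cards2; case: eqP. Qed.

Lemma adj_wt_gt0 G u v : adj G u v -> 0 < wt G [set u; v]%SET.
Proof. exact: wt_gt0. Qed.

Lemma walk_weight_nil G u : walk_weight G u [::] = 0.
Proof. by rewrite /walk_weight big_nil. Qed.

Lemma walk_weight_cons G u x p :
  walk_weight G u (x :: p) = wt G [set u; x]%SET + walk_weight G x p.
Proof. by rewrite /walk_weight /= big_cons. Qed.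

Lemma walk_weight_cat G u p1 p2 :
  walk_weight G u (p1 ++ p2) =
  walk_weight G u p1 + walk_weight G (last u p1) p2.
Proof.
elim: p1 u => [|x p1 IH] u; first by rewrite walk_weight_nil add0r.
by rewrite cat_cons !walk_weight_cons IH addrA.
Qed.

Lemma walk_weight_ge0 G u p : path (adj G) u p -> 0 <= walk_weight G u p.
Proof.
elim: p u => [|x p IH] u /=; first by rewrite walk_weight_nil.
by case/andP=> /adj_wt_gt0/ltW ? /IH ?; rewrite walk_weight_cons addr_ge0.
Qed.

(** A concrete walk stands for [dist G u v <= r], so that paths can be concatenated without handling
    infima in the extended reals. *)
Definition reach G u v r := exists p,
  [/\ path (adj G) u p, last u p = v & walk_weight G u p <= r].

Lemma reach_refl G u r : 0 <= r -> reach G u u r.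
Proof. by move=> r0; exists [::]; rewrite walk_weight_nil. Qed.

Lemma reach_le G u v r s : r <= s -> reach G u v r -> reach G u v s.
Proof. by move=> rs [p [? ? pr]]; exists p; split=> //; apply: le_trans rs. Qed.

Lemma reach_trans G u v x r s :
  reach G u v r -> reach G v x s -> reach G u x (r + s).
Proof.
move=> [p [pp <- pr]] [p' [pp' <- ps]]; exists (p ++ p').
by rewrite cat_path pp last_cat walk_weight_cat lerD.
Qed.

Lemma reach_adj G u v : adj G u v -> reach G u v (wt G [set u; v]%SET).
Proof.
by move=> uv; exists [:: v]; rewrite /= uv walk_weight_cons walk_weight_nil addr0.
Qed.

Lemma reach_sym G u v r : reach G u v r -> reach G v u r.
Proof.
case=> p [pp <- pr]; apply: (reach_le pr) => {pr}.
elim: p u pp => [|x p IH] u /=; first by rewrite walk_weight_nil => _;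
  apply: reach_refl.
case/andP=> ux /IH xp; rewrite walk_weight_cons addrC.
by apply: (reach_trans xp); rewrite finset.setUC; apply: reach_adj; rewrite adj_sym.
Qed.

Lemma reach_mono G H u v r :
  (forall a b, adj H a b -> adj G a b /\ wt G [set a; b]%SET = wt H [set a; b]%SET) ->
  reach H u v r -> reach G u v r.
Proof.
move=> HG [p [pp <- pr]]; apply: (reach_le pr) => {pr}.
elim: p u pp => [|x p IH] u /=; first by rewrite walk_weight_nil => _;
  apply: reach_refl.
case/andP=> /HG[ux ew] /IH xp; rewrite walk_weight_cons -ew.
by apply: reach_trans xp; apply: reach_adj.
Qed.

Lemma min_wt_le G e : e \in edges G -> min_wt G <= wt G e.
Proof. by move=> eG; apply: bigmin_le_cond. Qed.

Lemma max_wt_ge G e : e \in edges G -> wt G e <= max_wt G.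
Proof. by move=> eG; apply: le_bigmax_cond. Qed.

Lemma min_wt_gt0 G e : e \in edges G -> 0 < min_wt G.
Proof.
move=> eG; apply: lt_bigmin => [|f fG]; last exact: wt_gt0.
exact: lt_le_trans (wt_gt0 eG) (max_wt_ge eG).
Qed.

Lemma walk_weight_size G u p :
  path (adj G) u p -> min_wt G *+ size p <= walk_weight G u p.
Proof.
elim: p u => [|x p IH] u /=; first by rewrite walk_weight_nil.
case/andP=> ux /IH xp; rewrite walk_weight_cons mulrS lerD //.
exact: min_wt_le.
Qed.

(* Since weights are bounded below by [min_wt G > 0], only walks of bounded
   length compete for the minimum. *)
Lemma min_walk G u v : connect (adj G) u v -> exists p,
  [/\ path (adj G) u p, last u p = v
    & forall q, path (adj G) u q -> last u q = v ->
        walk_weight G u p <= walk_weight G u q].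
Proof.
case/connectP=> p0 pp0 lp0.
pose L := (Num.truncn (walk_weight G u p0 / min_wt G)).+1.
have szL q : path (adj G) u q -> walk_weight G u q <= walk_weight G u p0 ->
    (size q <= L)%N.
  case: q => [//|x q] pq le_q; have /andP[ux _] := pq.
  have m0 := min_wt_gt0 ux.
  rewrite /L -(ler_nat R); apply: le_trans (ltW (truncnS_gt _)).
  rewrite ler_pdivlMr // mulr_natl; apply: le_trans le_q.
  exact: walk_weight_size.
pose P (q : L.-bseq V) := path (adj G) u q && (last u q == v).
have P0 : P (Bseq (szL _ pp0 (lexx _))) by rewrite /P /= pp0 lp0 eqxx.
case: (arg_minP (fun q : L.-bseq V => walk_weight G u q) P0) =>
  p /andP[pp /eqP lp] minp.
exists p; split=> // q pq lq.
have [le_q|/ltW lt_q] := leP (walk_weight G u q) (walk_weight G u p0).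
  by apply: (minp (Bseq (szL _ pq le_q))); rewrite /P /= pq lq eqxx.
exact: le_trans (minp _ P0) lt_q.
Qed.

(** The infimum is attained by a minimal walk. Between distinct components no walk exists, and a
    finite bound on the infimum would produce one. *)
Lemma reach_dist G u v r : reach G u v r <-> (dist G u v <= r%:E)%E.
Proof.
split=> [[p [pp lp pr]]|].
  apply: le_trans (_ : (walk_weight G u p)%:E <= _)%E; last by rewrite lee_fin.
  by apply: ereal_inf_lbound; exists p.
case: (boolP (connect (adj G) u v)) => [/min_walk[p [pp lp minp]] | nuv].
  move=> dr; exists p; split=> //; rewrite -lee_fin; apply: le_trans dr.
  by apply: le_ereal_inf_tmp => _ [q [pq lq] <-]; rewrite lee_fin minp.
move=> dr; have : (dist G u v < (r + 1)%:E)%E.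
  by apply: le_lt_trans dr _; rewrite lte_fin ltrDl.
case/ereal_inf_lt=> _ [p [pp lp] _] _; case/negP: nuv.
by apply/connectP; exists p.
Qed.

Lemma dist_ge0 G u v : (0 <= dist G u v)%E.
Proof. by apply: le_ereal_inf_tmp => _ [q [pq lq] <-];
  rewrite lee_fin walk_weight_ge0. Qed.

(** Meaningful only for connected [u] and [v]: an infinite distance becomes the junk value 0. *)
Definition rdist G u v : R := fine (dist G u v).

Lemma rdistE G u v : connect (adj G) u v -> dist G u v = (rdist G u v)%:E.
Proof.
move=> /min_walk[p [pp lp _]].
have : (dist G u v <= (walk_weight G u p)%:E)%E by apply/reach_dist; exists p.
rewrite /rdist; have := dist_ge0 G u v.
by case: (dist G u v) => [r| |] //=; rewrite leey_eq.
Qed.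

Lemma rdist_le G u v r : connect (adj G) u v -> rdist G u v <= r <-> reach G u v r.
Proof. by move=> /rdistE uv; rewrite reach_dist uv lee_fin. Qed.

Lemma reach_rdist G u v : connect (adj G) u v -> reach G u v (rdist G u v).
Proof. by move=> uv; apply/rdist_le. Qed.

Lemma reach_connect G u v r : reach G u v r -> connect (adj G) u v.
Proof. by case=> p [pp lp _]; apply/connectP; exists p. Qed.

Lemma rdist_ge0 G u v : 0 <= rdist G u v.
Proof. exact: fine_ge0 (dist_ge0 G u v). Qed.

(** The first edge of a shortest walk; what remains of that walk is again shortest. *)
Lemma rdist_step G u v : connect (adj G) u v -> u != v ->
  exists2 x, adj G u x & rdist G u v = wt G [set u; x]%SET + rdist G x v.
Proof.
move=> uv neq_uv; have [p [pp lp pr]] := reach_rdist uv.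
case: p pp lp pr => [|x p] /=; first by move=> _ uv0; rewrite uv0 eqxx in neq_uv.
case/andP=> ux xp lp pr; exists x => //; apply/eqP; rewrite eq_le; apply/andP; split.
  apply/(rdist_le _ uv)/(reach_trans (reach_adj ux))/reach_rdist.
  by apply/connectP; exists p.
apply: le_trans pr; rewrite walk_weight_cons lerD2l.
have xv : reach G x v (walk_weight G x p) by exists p.
by apply/(rdist_le _ (reach_connect xv)).
Qed.

End Walks.

(** * Spanning trees and separated sets *)

Section Restriction.
Variables (R : realType) (V : finType) (G : wgraph R V) (F : {set {set V}}).

Lemma restr_card_edge e : e \in (edges G :&: F)%SET -> #|e| = 2%N.
Proof. by rewrite inE => /andP[/card_edge]. Qed.

Lemma restr_wt_gt0 e : e \in (edges G :&: F)%SET -> 0 < wt G e.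
Proof. by rewrite inE => /andP[/wt_gt0]. Qed.

Definition restr : wgraph R V := WGraph restr_card_edge restr_wt_gt0.

Lemma adj_restr u v : adj restr u v = adj G u v && ([set u; v]%SET \in F).
Proof. by rewrite /adj inE. Qed.

Lemma restr_subgraph : subgraph restr G.
Proof. by split=> //=; apply: finset.subsetIl. Qed.

End Restriction.

Section SpanningTrees.
Variables (R : realType) (V : finType).
Implicit Types (G T : wgraph R V) (u v x y : V) (N : {set V}).

Lemma restr_setT G : graph_connected G -> graph_connected (restr G [set: {set V}]%SET).
Proof.
move=> cG u v; rewrite (eq_connect (e' := adj G)) // => x y.
by rewrite adj_restr finset.in_setT andbT.
Qed.

(* A minimal set of edges that keeps [G] connected contains no cycle. *)
Lemma ex_spanning_tree G : graph_connected G -> exists T, spanning_tree G T.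
Proof.
move=> cG; pose P F := [forall u, forall v, connect (adj (restr G F)) u v].
have [|F /minsetP[/forallP cF minF]] := @ex_minset _ P.
  exists [set: {set V}]%SET; apply/forallP => u; apply/forallP => v.
  exact: restr_setT.
exists (restr G F); split; first exact: restr_subgraph.
  by move=> u v; have /forallP := cF u.
move=> [|a [|b [|d c]]] // /andP[cyc uniq_c].
have [/= ab bd dc] : [/\ adj (restr G F) a b, adj (restr G F) b d
    & path (adj (restr G F)) d (rcons c a)].
  by move: cyc => /= /and3P.
set e := [set a; b]%SET; have eF : e \in F by move: ab; rewrite adj_restr => /andP[].
suff /minF FF : P (F :\ e)%SET.
  by move: eF; rewrite -FF ?finset.subsetDl // !inE eqxx.
have neq : [/\ d != a, d != b, b != a & b \notin rcons c a].
  move: uniq_c; rewrite /= !inE !negb_or mem_rcons inE negb_or.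
  by case/and4P=> /and3P[/negbTE ab' /negbTE ad _] /andP[bd' bc] _ _;
    rewrite eq_sym ad eq_sym bd' eq_sym ab' bc.
case: neq => da db ba bc.
(* Only edges at [b] can be lost with [e]. The cycle is simple, so its part from [d] back to [a]
   avoids [b] and reconnects the ends of [e]. *)
have adjD x y : adj (restr G F) x y -> x != b -> y != b -> adj (restr G (F :\
  e)%SET) x y.
  rewrite !adj_restr !inE => /andP[-> ->] xb yb; rewrite andbT /=.
  apply/eqP => /finset.setP/(_ b); rewrite !inE eqxx orbT.
  by rewrite !(eq_sym b) (negbTE xb) (negbTE yb).
have cba : connect (adj (restr G (F :\ e)%SET)) b a.
  apply: (@connect_trans _ _ d).
    apply: connect1; move: bd; rewrite !adj_restr !inE => /andP[-> ->].
    rewrite andbT /=; apply/eqP => /finset.setP/(_ a); rewrite !inE eqxx.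
    by rewrite !(eq_sym a) (negbTE da) (negbTE ba).
  apply/connectP; exists (rcons c a); last by rewrite last_rcons.
  apply: (sub_in_path (P := [pred x | x != b])) dc => [x y xb yb xy|/=];
    first exact: adjD.
  by rewrite db; apply/allP => x /= xc; apply: contraNneq bc => <-.
have csym : connect_sym (adj (restr G (F :\ e)%SET)).
  by apply/sym_connect_sym/adj_sym.
apply/forallP => u; apply/forallP => v; have /forallP/(_ v) := cF u.
move: u v; apply: connect_sub => x y xy.
have [xyE|xyD] := eqVneq [set x; y]%SET e.
  have [] : x = a /\ y = b \/ x = b /\ y = a.
    have := adj_neq xy.
    have : x \in e by rewrite -xyE !inE eqxx.
    have : y \in e by rewrite -xyE !inE eqxx orbT.
    rewrite !inE => /orP[]/eqP-> /orP[]/eqP->; rewrite ?eqxx //; tauto.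
  - by case=> -> ->; rewrite csym.
  - by case=> -> ->.
by apply: connect1; move: xy; rewrite !adj_restr !inE xyD.
Qed.

Lemma weight_ge0 G : 0 <= weight G.
Proof. by apply: sumr_ge0 => e /wt_gt0/ltW. Qed.

(* Each new vertex is visited by a detour along an unused edge, back and forth. *)
Lemma ex_tour T u : graph_connected T -> exists p,
  [/\ path (adj T) u p, forall v, v \in u :: p & walk_weight T u p <= weight T *+ 2].
Proof.
move=> cT.
(* [F] holds the edges used so far. They join visited vertices only, so an edge towards a new vertex
   is not yet in [F] and its weight can be charged twice. *)
have grow k : (k <= #|V|)%N -> exists p (F : {set {set V}}),
  [/\ path (adj T) u p, F \subset edges T,
      forall e, e \in F -> e \subset [set x in u :: p]%SET,
      walk_weight T u p <= (\sum_(e in F) wt T e) *+ 2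
    & (k <= #|[set x in u :: p]%SET|)%N].
  elim: k => [_|k IH kV].
    exists [::], finset.set0; split=> //=; rewrite ?finset.sub0set //.
    - by move=> e; rewrite inE.
    - by rewrite walk_weight_nil mulrn_wge0 // sumr_ge0 // => e; rewrite inE.
  have [p [F [pp FT Fp wp kp]]] := IH (ltnW kV).
  have [kp'|] := ltnP k #|[set x in u :: p]%SET|; first by exists p, F.
  move=> pk; have {kp pk} kp : #|[set x in u :: p]%SET| = k by apply/eqP;
    rewrite eqn_leq kp pk.
  have [x [y [xp yp xy]]] : exists x y, [/\ x \in u :: p, y \notin u :: p & adj T x y].
    apply: contrapT => /forallNP noxy.
    have clp x y : x \in u :: p -> adj T x y -> y \in u :: p.
      move=> xp xy; case: (boolP (y \in u :: p)) => // yp.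
      by case: (noxy x); exists y.
    suff allp v : v \in u :: p.
      have : (#|V| <= k)%N.
        by rewrite -kp -cardsT; apply/subset_leq_card/fintype.subsetP => v _;
          rewrite inE.
      by rewrite leqNgt kV.
    have /connectP[q pq ->] := cT u v.
    have ext w : path (adj T) w q -> w \in u :: p -> last w q \in u :: p.
      elim: q w {pq} => [|z q IHq] w //= /andP[wz zq] wup.
      exact: IHq zq (clp _ _ wup wz).
    by apply: ext pq _; rewrite mem_head.
  have neF : [set x; y]%SET \notin F.
    apply: contra yp => /Fp/fintype.subsetP/(_ y); rewrite !inE eqxx orbT.
    exact.
  (* The walk is cut at a visit of [x], where the detour to [y] and back is inserted. *)
  case/splitPl: xp pp FT Fp wp kp yp neF xy => p1 p2 <-.
  rewrite cat_path => /andP[pp1 pp2] FT Fp wp kp yp neF xy.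
  set z := last u p1 in xy pp2 neF *.
  have sub v : v \in u :: p1 ++ y :: z :: p2 = (v == y) || (v \in u :: p1 ++ p2).
    have zp : z \in u :: p1 by rewrite mem_last.
    rewrite -!cat_cons !mem_cat (in_cons y) (in_cons z).
    case: (eqVneq v z) => [->|_] /=; by rewrite ?zp ?orbT // orbCA.
  have SE : [set v in u :: p1 ++ y :: z :: p2]%SET = (y |: [set v in u :: p1 ++
    p2])%SET.
    by apply/finset.setP => v; rewrite finset.in_setU1 !finset.in_set; apply: sub.
  exists (p1 ++ y :: z :: p2), ([set z; y] |: F)%SET; rewrite SE; split.
  - by rewrite cat_path pp1 /= xy adj_sym xy.
  - by rewrite finset.subUset finset.sub1set FT andbT.
  - move=> e; rewrite finset.in_setU1 => /predU1P[->|/Fp ep]; last first.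
      exact/(fintype.subset_trans ep)/finset.subsetUr.
    apply/fintype.subsetP => v; rewrite finset.in_set2 finset.in_setU1
      finset.in_set => /orP[]/eqP->.
      by rewrite -cat_cons mem_cat mem_last orbT.
    by rewrite eqxx.
  - rewrite big_setU1 //= mulrnDl.
    move: wp; rewrite !walk_weight_cat !walk_weight_cons -/z (finset.setUC [set y]%SET).
    rewrite mulr2n; lra.
  - by rewrite cardsU1 finset.in_set yp kp add1n.
have [p [F [pp FT _ wp Vp]]] := grow _ (leqnn _).
exists p; split=> // [v|].
  have /eqP : [set x in u :: p]%SET == [set: V]%SET.
    by rewrite eqEcard finset.subsetT cardsT.
  by move=> /finset.setP/(_ v); rewrite !inE.
apply: le_trans wp _; rewrite lerMn2r /=.
rewrite /weight [leRHS](big_setID F) /= (finset.setIidPr FT) lerDl.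
by apply: sumr_ge0 => e; rewrite inE => /andP[_ /wt_gt0/ltW].
Qed.

(** In the application [d] is the distance of [G] while the walk runs in a tree [T], so only growth
    along edges of [T] is assumed. The term [d z u] credits the way made since the last counted
    point [z]; at a point of [N] the credit has reached [r], and counting restarts there. *)
Lemma walk_weight_separated T (d : V -> V -> R) r N z u p :
  (forall x, d x x = 0) -> (forall x y, 0 <= d x y) ->
  (forall x a b, adj T a b -> d x b <= d x a + wt T [set a; b]%SET) ->
  {in N &, forall x y, x != y -> r <= d x y} ->
  {in N, forall x, r <= d z x} ->
  {subset N <= p} -> path (adj T) u p ->
  r *+ #|N| <= d z u + walk_weight T u p.
Proof.
move=> dxx d0 dT; elim: p N z u => [|a p IH] N z u sepN sepz subN /=.
  move=> _; have -> : N = finset.set0.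
    by apply/finset.setP => x; rewrite inE; apply/negP => /subN.
  by rewrite cards0 mulr0n walk_weight_nil addr0.
case/andP=> ua ap; rewrite walk_weight_cons addrA.
have dza := dT z _ _ ua.
have [aN|aN] := boolP (a \in N); last first.
  apply: le_trans (IH N z a sepN sepz _ ap) _; last by rewrite lerD2r.
  move=> x xN; have := subN _ xN; rewrite inE; case/predU1P=> // xa.
  by rewrite -xa xN in aN.
have : r *+ #|(N :\ a)%SET| <= d a a + walk_weight T a p.
  apply: IH => // [x y|x|x]; rewrite !inE.
  - by move=> /andP[_ xN] /andP[_ yN]; apply: sepN.
  - by move=> /andP[xa xN]; apply: sepN; rewrite // eq_sym.
  - by move=> /andP[xa /subN]; rewrite inE (negbTE xa).
rewrite dxx add0r (cardsD1 a N) aN add1n mulrS => IHa.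
by apply: lerD IHa; apply: le_trans (sepz _ aN) dza.
Qed.

Lemma rdist_triangle G u v x : graph_connected G ->
  rdist G u x <= rdist G u v + rdist G v x.
Proof.
by move=> cG; apply/rdist_le => //; apply: reach_trans; apply: reach_rdist.
Qed.

Lemma rdist_adj G u v : adj G u v -> rdist G u v <= wt G [set u; v]%SET.
Proof. by move=> uv; apply/rdist_le; [apply: connect1|apply: reach_adj]. Qed.

Lemma rdistxx G u : rdist G u u = 0.
Proof.
apply/eqP; rewrite eq_le rdist_ge0 andbT.
by apply/rdist_le; [apply: connect0|apply: reach_refl].
Qed.

(** A tour of any spanning tree weighs at most twice the tree and visits all of [N]. It starts at a
    point of [N], which is not paid for; hence the predecessor. *)
Lemma separated_mst G N r : graph_connected G ->
  {in N &, forall x y, x != y -> r <= rdist G x y} ->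
  r *+ #|N|.-1 <= mst_weight G *+ 2.
Proof.
move=> cG sepN; have [T0 T0G] := ex_spanning_tree cG.
rewrite -[leRHS]mulr_natl -ler_pdivrMl // mulrC.
apply: lb_le_inf => [|_ [T [[TG wTG] cT _] <-]]; first by exists (weight T0), T0.
rewrite ler_pdivrMr // mulr_natr.
have [->|[z zN]] := set_0Vmem N.
  by rewrite cards0 mulr0n mulrn_wge0 // weight_ge0.
have [p [pp allp wp]] := ex_tour z cT.
rewrite (cardsD1 z) zN /=; apply: le_trans wp.
have := @walk_weight_separated T (rdist G) r (N :\ z)%SET z z p.
rewrite rdistxx add0r; apply=> //.
- exact: rdistxx.
- exact: rdist_ge0.
- move=> x a b ab; rewrite wTG //; apply: le_trans (rdist_triangle _ a _ cG) _.
  by rewrite lerD2l rdist_adj //; apply: (fintype.subsetP TG).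
- by move=> x y; rewrite !inE => /andP[_ xN] /andP[_ yN]; apply: sepN.
- by move=> x; rewrite !inE => /andP[xz xN]; apply: sepN; rewrite // eq_sym.
- by move=> x; rewrite !inE => /andP[/negbTE xz _]; have := allp x; rewrite inE xz.
Qed.

End SpanningTrees.

(** * Shortest-path forests in a partition *)

(** Real values are not well-founded, but the number of elements with a smaller value decreases. *)
Lemma fin_lt_ind (R : realType) (T : finType) (f : T -> R) (P : T -> Prop) :
  (forall x, (forall y, f y < f x -> P y) -> P x) -> forall x, P x.
Proof.
move=> IH x; have [n] := ubnP #|[pred y | f y < f x]|.
elim: n x => // n IHn x; rewrite ltnS => fx; apply: IH => y yx.
apply/IHn/(leq_trans _ fx)/proper_card/fintype.properP; split.
  by apply/fintype.subsetP => z /=; rewrite !inE => /lt_trans; apply.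
by exists y; rewrite !inE ?ltxx.
Qed.

Lemma ler_sum_undup (R : numDomainType) (T : eqType) (s : seq T) (f : T -> R) :
  {in s, forall e, 0 <= f e} -> \sum_(e <- undup s) f e <= \sum_(e <- s) f e.
Proof.
elim: s => [//|a s IH] f0 /=; rewrite [leRHS]big_cons.
have /IH les : {in s, forall e, 0 <= f e} by move=> e es; apply: f0;
  rewrite inE es orbT.
case: ifP => _; last by rewrite big_cons lerD2l.
by rewrite -[leLHS]add0r lerD // f0 ?mem_head.
Qed.

(** A union bound: an element of [F] is charged to an index whose list contains it, and repetitions
    only enlarge the right-hand side. *)
Lemma ler_sum_cover (R : numDomainType) (T I : finType) (N : {set I})
    (s : I -> seq T) (F : {set T}) (f : T -> R) :
  {in N, forall x, {in s x, forall e, 0 <= f e}} ->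
  {in F, forall e, exists2 x, x \in N & e \in s x} ->
  \sum_(e in F) f e <= \sum_(x in N) \sum_(e <- s x) f e.
Proof.
move=> f0 Fs; apply: (@le_trans _ _ (\sum_(x in N) \sum_(e in F | e \in s x) f e)).
  rewrite (exchange_big_dep (mem F)) /=; last by move=> x e _ /andP[].
  apply: ler_sum => e eF; have [x xN ex] := Fs e eF.
  rewrite (bigD1 x) ?xN ?eF //= lerDl; apply: sumr_ge0 => y /andP[/andP[yN ey] _].
  exact: f0 ey.
apply: ler_sum => x xN; apply: (@le_trans _ _ (\sum_(e <- undup (s x)) f e)).
  rewrite big_uniq ?undup_uniq //= [leRHS](bigID (mem F)) /=.
  rewrite -[leLHS]addr0 lerD ?sumr_ge0 //.
    by rewrite le_eqVlt (eq_bigl (fun e =>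
      (e \in undup (s x)) && (e \in F))) ?eqxx // => e; rewrite mem_undup andbC.
  by move=> e; rewrite mem_undup => /andP[es _]; apply: f0 es.
by apply: ler_sum_undup => e es; apply: f0 es.
Qed.

Section Forests.
Variables (R : realType) (V : finType).
Implicit Types (G : wgraph R V) (u v x y : V) (p : seq V) (N : {set V}) (F : {set
  {set V}}).

Definition walk_edges u p : seq {set V} := pairmap (fun a b => [set a; b]%SET) u p.

Lemma walk_weightE G u p : walk_weight G u p = \sum_(e <- walk_edges u p) wt G e.
Proof.
elim: p u => [|x p IH] u; first by rewrite walk_weight_nil big_nil.
by rewrite walk_weight_cons big_cons IH.
Qed.

Lemma mem_walk_edges (r : rel V) u p e : path r u p -> e \in walk_edges u p ->
  exists a b, r a b /\ e = [set a; b]%SET.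
Proof.
elim: p u => [//|x p IH] u /= /andP[ux xp]; rewrite inE => /predU1P[->|];
  last exact: IH.
by exists u, x.
Qed.

Lemma path_restr G F u p : path (adj G) u p -> {subset walk_edges u p <= F} ->
  path (adj (restr G F)) u p.
Proof.
elim: p u => [//|x p IH] u /= /andP[ux xp] pF; rewrite adj_restr ux pF ?mem_head //=.
by apply: IH => // e ep; apply: pF; rewrite inE ep orbT.
Qed.

(** Each vertex points to a neighbour on a shortest walk to its root. One map [par] serves all
    vertices, so all these walks together use at most one edge per vertex. *)
Lemma shortest_path_forest G (root : V -> V) :
  (forall a b, adj G a b -> root a = root b) ->
  (forall x, connect (adj G) x (root x)) ->
  exists par : V -> V, forall x, exists p,
    [/\ path (fun a b => adj G a b && (b == par a)) x p, last x p = root x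
      & walk_weight G x p <= rdist G x (root x)].
Proof.
move=> rootE croot.
pose next x y := adj G x y &&
  (rdist G x (root x) == wt G [set x; y]%SET + rdist G y (root y)).
pose par x := odflt x [pick y | next x y].
have parP x : x != root x -> next x (par x).
  move=> /(rdist_step (croot x))[y xy dxy]; rewrite /par; case: pickP => [//|/(_ y)].
  by rewrite /next xy -(rootE _ _ xy) dxy eqxx.
exists par; apply: (@fin_lt_ind _ _ (fun x => rdist G x (root x))) => x IH.
have [xr|/parP/andP[xy /eqP dy]] := eqVneq x (root x).
  by exists [::]; split; rewrite // walk_weight_nil rdist_ge0.
have [|p [pp lp wp]] := IH (par x); first by rewrite dy ltrDr (adj_wt_gt0 xy).
exists (par x :: p); rewrite /= pp xy eqxx lp (rootE _ _ xy).
by rewrite walk_weight_cons -(rootE _ _ xy) dy lerD2l.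
Qed.

Lemma partition_forest G (P : {set {set V}}) N r :
  finset.partition P [set: V]%SET ->
  (forall A, A \in P -> (strong_diam G A <= r%:E)%E) ->
  exists F, [/\ F \subset edges G, (#|F| <= #|V|)%N,
    \sum_(e in F) wt G e <= r *+ #|N|
  & forall u v, u \in N -> v \in N -> v \in finset.pblock P u ->
      reach (restr G F) u v (r + r)].
Proof.
move=> /and3P[/eqP covP triP _] diamP.
have inb x : x \in finset.pblock P x by rewrite mem_pblock covP finset.in_setT.
have bP x : finset.pblock P x \in P by rewrite pblock_mem // covP finset.in_setT.
(* Only edges inside clusters are kept, so a single forest treats all clusters at once and its walks
   never leave them. *)
pose GP := restr G [set e : {set V} | [exists A in P, e \subset A]]%SET.
(* The choice depends on the cluster alone, hence its vertices share one root. *)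
pose root x := odflt x [pick y in finset.pblock P x].
have rootb x : root x \in finset.pblock P x by rewrite /root; case: pickP.
have rootE a b : finset.pblock P a = finset.pblock P b -> root a = root b.
  by rewrite /root => ->; case: pickP => // /(_ b); rewrite inb.
have rootP x : reach GP x (root x) r.
  have : reach (induced G (finset.pblock P x)) x (root x) r.
    apply/reach_dist/(le_trans _ (diamP _ (bP x))).
    apply: le_trans (le_bigmax_cond _ _ (inb x)).
    exact: (le_bigmax_cond _ _ (rootb x)).
  apply: reach_mono => a b; rewrite /adj inE => /andP[abG abx]; split=> //.
  by rewrite !inE abG; apply/existsP; exists (finset.pblock P x); rewrite bP.
have [|x|par /fin_all_exists[w wP]] := @shortest_path_forest GP root.
- move=> a b; rewrite adj_restr inE => /andP[_ /existsP[A /andP[AP abA]]].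
  apply: rootE; rewrite !(@def_pblock _ _ A) //; apply: (fintype.subsetP abA).
    by rewrite !inE eqxx orbT.
  by rewrite !inE eqxx.
- exact: reach_connect (rootP x).
have wpath x : path (adj G) x (w x).
  have [pw _ _] := wP x; apply: sub_path pw => a b.
  by rewrite adj_restr => /andP[/andP[]].
have wle x : walk_weight G x (w x) <= r.
  have [_ _ ww] := wP x; apply: le_trans ww _.
  by apply/rdist_le; [apply: reach_connect (rootP x)|].
pose F := [set e : {set V} | [exists x in N, e \in walk_edges x (w x)]]%SET.
have reachF x : x \in N -> reach (restr G F) x (root x) r.
  move=> xN; exists (w x); split; [|by have [] := wP x|exact: wle].
  apply: path_restr => // e ex; rewrite inE; apply/existsP; exists x.
  by rewrite xN.
exists F; split.
- apply/fintype.subsetP => e; rewrite inE => /existsP[x /andP[_]].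
  by case/(mem_walk_edges (wpath x)) => a [b [ab ->]].
- apply: leq_trans (leq_imset_card (fun a => [set a; par a]%SET) _).
  apply/subset_leq_card/fintype.subsetP => e; rewrite inE => /existsP[x /andP[_]].
  have [pw _ _] := wP x; case/(mem_walk_edges pw) => a [b [/andP[_ /eqP->] ->]].
  exact: imset_f.
- apply: (@le_trans _ _ (\sum_(x in N) \sum_(e <- walk_edges x (w x)) wt G e)).
    apply: ler_sum_cover => [x _ e|e].
      case/(mem_walk_edges (wpath x)) => a [b [ab ->]].
      exact/ltW/(adj_wt_gt0 ab).
    by rewrite inE => /existsP[x /andP[xN ex]]; exists x.
  rewrite -sumr_const; apply: ler_sum => x _.
  by rewrite -walk_weightE.
- move=> u v uN vN vu; apply: reach_trans (reachF _ uN) _.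
  rewrite (rootE u v); first exact/reach_sym/reachF.
  by apply/esym/same_pblock.
Qed.

End Forests.

(** * Greedy covering *)

Section Covering.
Variables (R : realType) (T J : finType) (D : T -> R) (delta : R).
Variable cov : T -> pred J.
Implicit Type S : {set J}.
Hypotheses (D_ge0 : forall P, 0 <= D P) (sumD : \sum_P D P = 1).

(** Averaging: the expected number of covered elements is at least [delta * #|S|], so some outcome
    of positive probability reaches it. *)
Lemma average_cover S :
  {in S, forall j, delta <= \sum_(P | cov P j) D P} ->
  exists2 P, D P != 0 & delta * #|S|%:R <= #|[set j in S | cov P j]%SET|%:R.
Proof.
move=> covS; pose g P : R := delta * #|S|%:R - #|[set j in S | cov P j]%SET|%:R.
apply: contrapT => noP.
have g_gt0 P : D P != 0 -> 0 < g P.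
  by move=> DP; rewrite subr_gt0 ltNge; apply/negP => le; apply: noP; exists P.
have Dg0 P : 0 <= D P * g P.
  by have [->|/g_gt0/ltW] := eqVneq (D P) 0; [rewrite mul0r | apply: mulr_ge0].
have sumDg : \sum_P D P * g P <= 0.
  rewrite (eq_bigr (fun P => D P * (delta * #|S|%:R) - \sum_(j in S | cov P j) D P)).
    rewrite sumrB -mulr_suml sumD mul1r subr_le0 (exchange_big_dep (mem S)) /=;
      last first.
      by move=> P j _ /andP[].
    rewrite mulr_natr -sumr_const; apply: ler_sum => j jS.
    by rewrite (eq_bigl (fun P => cov P j)) ?covS // => P; rewrite jS.
  move=> P _; rewrite mulrBr; congr (_ - _).
  rewrite mulr_natr -sumr_const; apply: eq_bigl => j; rewrite inE //.
(* Nonnegative terms with a nonpositive sum vanish, while [g] is positive on the support; so [D]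
   would vanish everywhere. *)
have /eqP : \sum_P D P = 0.
  apply: big1 => P _; apply/eqP; apply: contraT => DP.
  have /psumr_eq0P : \sum_P D P * g P = 0 by apply/eqP; rewrite eq_le sumDg sumr_ge0.
  move=> /(_ (fun P _ => Dg0 P) P isT)/eqP; rewrite mulf_eq0 (negbTE DP) /=.
  by rewrite gt_eqF ?g_gt0.
by rewrite sumD oner_eq0.
Qed.

(* Choosing greedily, each new element covers a [delta] fraction of what is
   still uncovered. *)
Lemma greedy_cover S m : delta <= 1 ->
  {in S, forall j, delta <= \sum_(P | cov P j) D P} ->
  exists s : seq T, [/\ size s = m, {in s, forall P, D P != 0}
    & #|[set j in S | ~~ has (cov^~ j) s]%SET|%:R <= (1 - delta) ^+ m * #|S|%:R].
Proof.
move=> d1 covS; elim: m => [|m [s [<- sD ls]]].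
  exists [::]; split=> //; rewrite expr0 mul1r ler_nat.
  by apply/subset_leq_card/fintype.subsetP => j; rewrite inE => /andP[].
set S' := [set _ in S | _]%SET in ls.
have [|P DP covP] := @average_cover S'.
  by move=> j; rewrite inE => /andP[/covS].
exists (P :: s); split=> //.
  by move=> Q; rewrite inE => /predU1P[->|/sD].
rewrite exprS -mulrA; apply: le_trans (ler_wpM2l _ ls); last by rewrite subr_ge0.
rewrite mulrBl mul1r lerBrDr; apply: le_trans (lerD (lexx _) covP) _.
rewrite -natrD ler_nat -cardsUI [X in (_ + X)%N](_ : _ = 0)%N ?addn0.
  apply/subset_leq_card/fintype.subsetP => j; rewrite !inE /= => /orP[|/andP[]//].
  by rewrite negb_or => /and3P[-> _ ->].
apply: eq_card0 => j; rewrite !inE /=; case: (cov P j) => /=; rewrite ?andbF //.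
Qed.

(** The number of uncovered elements is a natural number below 1. *)
Lemma full_cover S m : delta <= 1 -> (1 - delta) ^+ m * #|S|%:R < 1 ->
  {in S, forall j, delta <= \sum_(P | cov P j) D P} ->
  exists s : seq T, [/\ size s = m, {in s, forall P, D P != 0}
    & {in S, forall j, has (cov^~ j) s}].
Proof.
move=> d1 small /(greedy_cover m d1)[s [sm sD ls]]; exists s; split=> // j jS.
have := le_lt_trans ls small; rewrite -[1]/(1%:R) ltr_nat ltnS leqn0 cards_eq0 =>
  /eqP/finset.setP/(_ j).
by rewrite !inE jS /= => /negbFE.
Qed.

End Covering.

(** * Logarithmic estimates and the number of greedy rounds *)

Section Logarithms.
Variable R : realType.
Implicit Types x : R.

Lemma ln2_le1 : ln 2 <= 1 :> R.
Proof.
rewrite -[leRHS]expRK ler_ln ?posrE ?expR_gt0 //.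
by apply: le_trans (expR_ge1Dx 1).
Qed.

Lemma ln2_gt0 : 0 < ln 2 :> R.
Proof. by rewrite ln_gt0 // ltr1n. Qed.

Lemma ln_le_log2 x : 1 <= x -> ln x <= log2 x.
Proof.
by move=> x1; rewrite /log2 ler_pdivlMr ?ln2_gt0 // ler_piMr ?ln_ge0 // ln2_le1.
Qed.

Lemma log2_ge1 n : (1 < n)%N -> 1 <= log2 (n%:R : R).
Proof.
move=> n1; rewrite /log2 ler_pdivlMr ?ln2_gt0 // mul1r.
by rewrite ler_ln ?posrE ?ltr0n ?ler_nat // ltnW.
Qed.

(** From [ln y <= y - 1] at the inverse of [1 + x]. *)
Lemma ln1D_ge x : 0 <= x -> x <= 1 -> x / 2 <= ln (1 + x).
Proof.
move=> x0 x1; have px : 0 < 1 + x by lra.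
have : ln (1 + x)^-1 <= (1 + x)^-1 - 1.
  have iv : 0 < (1 + x)^-1 by rewrite invr_gt0.
  have := expR_ge1Dx (ln (1 + x)^-1); rewrite lnK ?posrE // => ?; lra.
rewrite lnV ?posrE // => le; suff : x / 2 <= 1 - (1 + x)^-1 by lra.
have -> : 1 - (1 + x)^-1 = x / (1 + x) by field; lra.
by rewrite ler_pdivlMr // ; nra.
Qed.

(** With [m > 2 ln n / delta], the power is at most [expR (- delta * m)], which is below the inverse
    of [n * n], the number of vertex pairs. Rounding up costs 1, absorbed by
    [log2 n / delta >= 1]. *)
Lemma rounds (delta : R) n : (1 < n)%N -> 0 < delta -> delta <= 1 ->
  exists m : nat, (1 - delta) ^+ m * (n * n)%:R < 1 /\
    m%:R <= 3 * (log2 (n%:R : R) / delta).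
Proof.
move=> n1 d0 d1; have n0 : 0 < (n%:R : R) by rewrite ltr0n ltnW.
have l1 := log2_ge1 n1; have ll : ln n%:R <= log2 (n%:R : R) by apply: ln_le_log2;
  rewrite ler1n ltnW.
have l0 : 0 <= ln (n%:R : R) by rewrite ln_ge0 // ler1n ltnW.
exists (Num.truncn (2 * ln n%:R / delta)).+1; split.
  have le : (1 - delta) ^+ (Num.truncn (2 * ln n%:R / delta)).+1 <=
      expR (- delta * (Num.truncn (2 * ln n%:R / delta)).+1%:R).
    by rewrite expRM_natr lerXn2r ?nnegrE ?subr_ge0 ?expR_ge0 // expR_ge1Dx.
  apply: le_lt_trans (ler_wpM2r (ler0n _ _) le) _.
  have -> : (n * n)%:R = expR (2 * ln n%:R) :> R.
    by rewrite expRM_natl lnK ?posrE // natrM expr2.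
  rewrite -expRD expR_lt1 mulNr addrC subr_lt0.
  rewrite -ltr_pdivrMl // mulrC; exact: truncnS_gt.
set k := Num.truncn _; have le : k%:R <= 2 * ln n%:R / delta.
  by rewrite truncn_le divr_ge0 ?mulr_ge0 // ltW.
rewrite -natr1; apply: le_trans (lerD le (lexx 1)) _.
have dl : 1 <= log2 n%:R / delta by rewrite ler_pdivlMr // mul1r; lra.
have : ln n%:R / delta <= log2 n%:R / delta by rewrite ler_pM2r ?invr_gt0.
rewrite -mulrA; lra.
Qed.

End Logarithms.

(** * Sums over the scales *)

Section Sums.
Variable R : realType.
Implicit Types (a q M B L Y g e : R).

Lemma geometric_sum_le a q B K : 0 <= a -> 1 <= q -> 0 <= B ->
  \sum_(0 <= i < K | a * q ^+ i <= B) a * q ^+ i * (q - 1) <= q * B.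
Proof.
move=> a0 q1 B0; have q0 : 0 <= q := le_trans ler01 q1.
(* The second bound, by the next term, telescopes; it yields the first bound at each retained
   index. *)
suff [] : \sum_(0 <= i < K | a * q ^+ i <= B) a * q ^+ i * (q - 1) <= q * B /\
  \sum_(0 <= i < K | a * q ^+ i <= B) a * q ^+ i * (q - 1) <= a * q ^+ K by [].
elim: K => [|K [IH1 IH2]].
  by rewrite big_geq // !mulr_ge0 ?exprn_ge0.
have aqK : 0 <= a * q ^+ K by rewrite mulr_ge0 ?exprn_ge0.
rewrite big_mkcond big_nat_recr //= -big_mkcond /= exprSr mulrA.
case: ifP => [aB|_]; last by rewrite addr0; split=> //; nra.
by split; nra.
Qed.

(** The left-hand side is [L] times the number of terms of a progression lying between 0 and [Y].
    The induction also bounds it by the positive part of the next term. *)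
Lemma arithmetic_count_le g L Y K : 0 <= L -> 0 <= Y ->
  \sum_(0 <= i < K | (0 < g + L * i%:R) && (g + L * i%:R <= Y)) L <= Y + L.
Proof.
move=> L0 Y0.
suff [] : \sum_(0 <= i < K | (0 < g + L * i%:R) && (g + L * i%:R <= Y)) L <= Y + L /\
  \sum_(0 <= i < K | (0 < g + L * i%:R) && (g + L * i%:R <= Y)) L
    <= Num.max 0 (g + L * K%:R) by [].
elim: K => [|K [IH1 IH2]].
  by rewrite big_geq // addr_ge0 // le_max lexx.
rewrite big_mkcond big_nat_recr //= -big_mkcond /=.
rewrite -natr1 mulrDr mulr1; set gK := g + L * K%:R in IH2 *.
rewrite le_max in IH2; rewrite addrA -/gK le_max.
case: ifP => [/andP[gK0 gKY]|_].
  by case/orP: IH2 => ?; split; try lra; apply/orP; right; lra.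
rewrite addr0; split=> //; case/orP: IH2 => ?; apply/orP; [left|right]; lra.
Qed.

(* Scales below [M / n] contribute a geometric series; only [O(log n / e)]
   scales lie between [M / n] and [2 M]. *)
Lemma scale_sum_le a e M (c : nat -> R) n K :
  0 < a -> 0 < e -> e <= 1 -> 0 < M -> (1 < n)%N ->
  (forall i, c i <= n%:R * (a * (1 + e) ^+ i)) ->
  (forall i, a * (1 + e) ^+ i <= M *+ 2 -> c i <= 4 * M / e) ->
  \sum_(0 <= i < K | a * (1 + e) ^+ i <= M *+ 2) c i
    <= 26 * M * log2 n%:R / e ^+ 2.
Proof.
move=> a0 e0 e1 M0 n1 cn cM.
have n0 : 0 < (n%:R : R) by rewrite ltr0n ltnW.
have l1 : 1 <= log2 (n%:R : R) := log2_ge1 R n1.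
have ll : ln n%:R <= log2 (n%:R : R) by apply: ln_le_log2; rewrite ler1n ltnW.
have l0 : 0 <= ln (n%:R : R) by rewrite ln_ge0 // ler1n ltnW.
have q0 : 0 < 1 + e by lra.
have d0 i : 0 < a * (1 + e) ^+ i by rewrite mulr_gt0 ?exprn_gt0.
rewrite (bigID (fun i => a * (1 + e) ^+ i <= M / n%:R)) /=.
have small : \sum_(0 <= i < K |
    (a * (1 + e) ^+ i <= M *+ 2) && (a * (1 + e) ^+ i <= M / n%:R)) c i
    <= 2 * M / e.
  apply: (@le_trans _ _ (\sum_(0 <= i < K |
    a * (1 + e) ^+ i <= M / n%:R) n%:R * (a * (1 + e) ^+ i))).
    rewrite [leLHS]big_mkcond [leRHS]big_mkcond; apply: ler_sum => i _.
    by case: ifP => [/andP[_ ->]//|_]; case: ifP => // _; rewrite mulr_ge0 // ltW.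
  have := @geometric_sum_le a (1 + e) (M / n%:R) K (ltW a0).
  rewrite (_ : 1 + e - 1 = e) -?mulr_suml -?mulr_sumr; last by lra.
  rewrite -ler_pdivlMr // => /(_ _ _)/(ler_wpM2l (ltW n0)) le.
  apply: le_trans (le _ _) _; [lra | by rewrite divr_ge0 // ltW |].
  rewrite -subr_ge0 (_ : _ - _ = M * (1 - e) / e); last by field; lra.
  by rewrite divr_ge0 ?mulr_ge0 //; lra.
have lq := ln1D_ge (ltW e0) e1.
have lq0 : 0 < ln (1 + e) by lra.
have large : \sum_(0 <= i < K |
    (a * (1 + e) ^+ i <= M *+ 2) && ~~ (a * (1 + e) ^+ i <= M / n%:R)) c i
    <= 24 * M * log2 n%:R / e ^+ 2.
  pose x := M / n%:R; have x0 : 0 < x by rewrite divr_gt0.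
  (* In logarithmic coordinates the scales between [M / n] and [2 M] form a progression of step
     [ln (1 + e)] in an interval of length [Y]. *)
  pose g := ln a - ln x; pose Y := ln (M *+ 2) - ln x.
  have gE i : ln (a * (1 + e) ^+ i) = ln x + (g + ln (1 + e) * i%:R).
    by rewrite lnM ?posrE ?exprn_gt0 // lnXn // /g -mulr_natr; lra.
  have YE : Y = ln 2 + ln n%:R.
    rewrite /Y /x ln_div ?posrE // -(mulr_natl M 2) lnM ?posrE //; lra.
  have Y0 : 0 <= Y by rewrite YE; have := ln2_gt0 R; lra.
  apply: (@le_trans _ _ (\sum_(0 <=
    i < K | (0 < g + ln (1 + e) * i%:R) && (g + ln (1 + e) * i%:R <= Y)) 4 * M / e)).
    rewrite (eq_bigl (fun i => (0 < g + ln (1 + e) * i%:R) && (g + ln (1 + e) *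
      i%:R <= Y))).
      apply: ler_sum => i /andP[_ gY]; apply: cM.
      rewrite -ler_ln ?posrE ?pmulrn_lgt0 // gE; move: gY; rewrite /Y; lra.
    move=> i; rewrite -ltNge andbC -ltr_ln ?posrE // -[X in _ && X]ler_ln ?posrE
      ?pmulrn_lgt0 //.
    rewrite gE -/x; congr (_ && _); [by rewrite ltrDl | by rewrite /Y lerBrDl].
  have := arithmetic_count_le g K (ltW lq0) Y0.
  set S := \sum_(0 <= i < K | _) _; set S' := \sum_(0 <= i < K | _) _.
  have -> : S = ln (1 + e) * \sum_(0 <=
    i < K | (0 < g + ln (1 + e) * i%:R) && (g + ln (1 + e) * i%:R <= Y)) 1.
    by rewrite mulr_sumr; apply: eq_bigr => i _; rewrite mulr1.
  have -> : S' = 4 * M / e * \sum_(0 <=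
    i < K | (0 < g + ln (1 + e) * i%:R) && (g + ln (1 + e) * i%:R <= Y)) 1.
    by rewrite mulr_sumr; apply: eq_bigr => i _; rewrite mulr1.
  set c0 := \sum_(_ <= _ < _ | _) _ => cle.
  have c00 : 0 <= c0 by apply: sumr_ge0.
  have lq1 : ln (1 + e) <= 1 by apply: le_trans (le_ln1Dx _) _; lra.
  have := ln2_le1 R => l2.
  (* Each of [ln 2], [ln n] and [ln (1 + e)] is at most [log2 n], whence the 3. *)
  have cle' : e / 2 * c0 <= 3 * log2 n%:R by rewrite YE in cle; nra.
  rewrite -subr_ge0 (_ : _ - _ = 8 * M / e ^+ 2 * (3 * log2 n%:R - e / 2 * c0)).
    by rewrite mulr_ge0 ?subr_ge0 ?divr_ge0 ?mulr_ge0 ?exprn_ge0 // ltW.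
  by field; lra.
apply: le_trans (lerD small large) _.
rewrite -subr_ge0 (_ : _ - _ = 2 * M * (log2 n%:R - e) / e ^+ 2); last by field; lra.
by rewrite divr_ge0 ?mulr_ge0 ?exprn_ge0 //; lra.
Qed.

Lemma scale_index a q w K : a <= w -> w < a * q ^+ K ->
  exists2 i, (i < K)%N & a * q ^+ i <= w /\ w < a * q ^+ i.+1.
Proof.
move=> aw; elim: K => [|K IH] wK; first by move: wK; rewrite mulr1 ltNge aw.
have [/IH[i iK iw]|le] := ltP w (a * q ^+ K); last by exists K.
by exists i; rewrite // ltnW.
Qed.

(** The maximum with 1 absorbs the rounding when [x] is close to 1. *)
Lemma number_of_scales x e : 1 <= x -> 0 < e -> e <= 1 -> exists K : nat,
  x < (1 + e) ^+ K /\ K%:R <= 3 / e * Num.max 1 (log2 x).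
Proof.
move=> x1 e0 e1; have lq := ln1D_ge (ltW e0) e1.
have lq0 : 0 < ln (1 + e) by lra.
have lx := ln_ge0 x1.
exists (Num.truncn (ln x / ln (1 + e))).+1; split.
  rewrite -ltr_ln ?posrE ?exprn_gt0 ?lnXn; try lra.
  by rewrite -mulr_natr mulrC -ltr_pdivrMr // truncnS_gt.
set k := Num.truncn _; have le : k%:R <= ln x / ln (1 + e).
  by rewrite truncn_le divr_ge0 // ltW.
have mlog : ln x <= Num.max 1 (log2 x) by rewrite le_max ln_le_log2 ?orbT.
have m1 : 1 <= Num.max 1 (log2 x) by rewrite le_max lexx.
set m := Num.max _ _ in mlog m1 *.
rewrite -natr1; apply: le_trans (lerD le (lexx 1)) _.
have : ln x / ln (1 + e) <= 2 / e * m.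
  rewrite ler_pdivrMr //.
  have -> : 2 / e * m * ln (1 + e) = m * (ln (1 + e) / (e / 2)) by field; lra.
  have : 1 <= ln (1 + e) / (e / 2) by rewrite ler_pdivlMr ?mul1r //; lra.
  nra.
have : m <= m / e by rewrite ler_pdivlMr //; nra.
have -> : 3 / e * m = 2 / e * m + m / e by lra.
lra.
Qed.

End Sums.

(** * Spanners from decompositions *)

Section Spanners.
Variables (R : realType) (V : finType) (G : wgraph R V).
Implicit Types (u v x : V) (N : {set V}) (F : {set {set V}}) (r t e delta : R).

Lemma sum_setU_le F1 F2 : F1 \subset edges G -> F2 \subset edges G ->
  \sum_(e in F1 :|: F2) wt G e <= \sum_(e in F1) wt G e + \sum_(e in F2) wt G e.
Proof.
move=> F1G F2G; rewrite [leLHS](big_setID F1) [X in _ <= _ + X](big_setID F1) /=.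
rewrite finset.setUK finset.setDUl finset.setDv finset.set0U lerD2l lerDr.
apply: sumr_ge0 => f /finset.setIP[/(fintype.subsetP F2G)/wt_gt0/ltW] //.
Qed.

Lemma reach_restrS F1 F2 u v r : F1 \subset F2 ->
  reach (restr G F1) u v r -> reach (restr G F2) u v r.
Proof.
move=> F12; apply: reach_mono => a b; rewrite !adj_restr => /andP[-> abF].
by rewrite (fintype.subsetP F12).
Qed.

(** [Q i] lists what the [i]-th edge set must connect. It stays abstract because the lemma merges
    both the partitions of one scale and the scales themselves. *)
Lemma union_restr (I : eqType) (s : seq I) (a : I -> nat) (b : I -> R)
    (Q : I -> V -> V -> R -> Prop) :
  {in s, forall i, exists F, [/\ F \subset edges G, (#|F| <= a i)%N,
     \sum_(e in F) wt G e <= b i & forall u v r, Q i u v r -> reach (restr G F) u v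
       r]} ->
  exists F, [/\ F \subset edges G, (#|F| <= \sum_(i <- s) a i)%N,
     \sum_(e in F) wt G e <= \sum_(i <- s) b i
   & {in s, forall i u v r, Q i u v r -> reach (restr G F) u v r}].
Proof.
elim: s => [|i s IH] sF.
  by exists finset.set0; rewrite !big_nil finset.sub0set cards0 big_set0.
have [|F [FG aF bF QF]] := IH; first by move=> j js; apply: sF; rewrite inE js orbT.
have [Fi [FiG aFi bFi QFi]] := sF i (mem_head _ _).
exists (Fi :|: F)%SET; split.
- by rewrite finset.subUset FiG FG.
- by rewrite big_cons; apply: leq_trans (leq_card_setU _ _) (leq_add _ _).
- by rewrite big_cons; apply: le_trans (sum_setU_le FiG FG) (lerD _ _).
move=> j; rewrite inE => /predU1P[->|js] u v r Qj.
  by apply: reach_restrS (QFi _ _ _ Qj); apply: finset.subsetUl.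
by apply: reach_restrS (QF _ js _ _ _ Qj); apply: finset.subsetUr.
Qed.

Lemma rdist_sym u v : graph_connected G -> rdist G u v = rdist G v u.
Proof.
move=> cG; apply/eqP; rewrite eq_le.
by apply/andP; split; apply/rdist_le => //; apply/reach_sym/reach_rdist.
Qed.

(** A maximal separated set: a vertex far from all its points could be added. *)
Lemma ex_net r : graph_connected G -> 0 <= r -> exists N,
  {in N &, forall x y, x != y -> r <= rdist G x y} /\
  forall u, exists2 x, x \in N & rdist G u x <= r.
Proof.
move=> cG r0.
pose sep N := [forall x in N, forall y in N, (x != y) ==> (r <= rdist G x y)].
have sepP N : reflect {in N &, forall x y, x != y -> r <= rdist G x y} (sep N).
  apply: (iffP forall_inP) => [h x y /h/forall_inP hx /hx/implyP //|h x xN].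
  by apply/forall_inP => y yN; apply/implyP/h.
have [|N /maxsetP[/sepP sepN maxN]] := @ex_maxset _ sep.
  by exists finset.set0; apply/sepP => x; rewrite inE.
exists N; split=> // u; apply: contrapT => noN.
have far x : x \in N -> r <= rdist G u x.
  by move=> xN; rewrite leNgt; apply/negP => /ltW ux; apply: noN; exists x.
have sepu : sep (u |: N)%SET.
  apply/sepP => x y; rewrite !inE => /predU1P[->|xN] /predU1P[->|yN];
    first by rewrite eqxx.
  - by move=> _; apply: far.
  - by move=> _; rewrite rdist_sym //; apply: far.
  - exact: sepN.
apply: noN; exists u; last by rewrite rdistxx.
by rewrite -(maxN _ sepu (finset.subsetUr _ _)) !inE eqxx.
Qed.

Lemma scale_forest t delta Delta N m :
  graph_connected G -> delta <= 1 -> strongly_decomposable t delta G ->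
  0 < Delta -> (1 - delta) ^+ m * (#|V| * #|V|)%:R < 1 ->
  exists F, [/\ F \subset edges G, (#|F| <= m * #|V|)%N,
     \sum_(e in F) wt G e <= m%:R * (t * Delta * #|N|%:R)
   & {in N &, forall u v, rdist G u v <= Delta ->
        reach (restr G F) u v (t * Delta + t * Delta)}].
Proof.
move=> cG d1 dec D0 small; have [D [[Dge0 sumD partD] diamD covD]] := dec _ D0.
(* All close pairs of vertices are covered, at most [#|V| * #|V|] of them. *)
pose S := [set uv : V * V | rdist G uv.1 uv.2 <= Delta]%SET.
pose cov (P : {set {set V}}) (uv : V * V) := uv.2 \in finset.pblock P uv.1.
have [||s [ss sD covs]] := @full_cover R _ _ D delta cov Dge0 sumD S m d1.
- apply: le_lt_trans small; rewrite ler_wpM2l ?exprn_ge0 ?subr_ge0 //.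
  by rewrite ler_nat -card_prod max_card.
- by move=> [u v]; rewrite inE /= => uv; apply: covD; rewrite rdistE // lee_fin.
have [P Ps|F [FG aF bF QF]] := @union_restr _ s (fun=> #|V|) (fun=> t * Delta *+ #|N|)
  (fun P u v r => [/\ u \in N, v \in N, v \in finset.pblock P u &
    r = t * Delta + t * Delta]).
  have [F [FG aF bF QF]] := partition_forest N (partD _ (sD _ Ps))
    (fun A AP => diamD P A (sD _ Ps) AP).
  exists F; split=> // u v r [uN vN uv ->]; exact: QF.
exists F; split=> //.
- by apply: leq_trans aF _; rewrite big_const_seq count_predT iter_addn_0 ss mulnC.
- by apply: le_trans bF _; rewrite big_const_seq count_predT iter_addr_0 ss
  mulr_natr mulr_natl.
- move=> u v uN vN uv; have /hasP[P Ps uvP] := covs (u, v) ltac:(by rewrite inE).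
  exact: QF Ps _ _ _ _.
Qed.

(* Induction on [rdist G u v]: an edge of weight [w] that is a shortest path is
   replaced by [u ~> u' ~> v' ~> v], where only the middle part is bounded
   directly. *)
Lemma stretch_induction H t e :
  graph_connected G -> 0 <= t -> 0 < e -> e <= 12^-1 ->
  (forall u v, adj G u v -> wt G [set u; v]%SET = rdist G u v -> exists u' v',
     [/\ rdist G u u' <= e * rdist G u v, rdist G v v' <= e * rdist G u v
       & reach H u' v' (2 * t * (1 + 3 * e) * rdist G u v)]) ->
  forall u v, reach H u v (t * (2 + 12 * e) * rdist G u v).
Proof.
move=> cG t0 e0 e1 edgeH u v.
have k0 : 0 <= t * (2 + 12 * e) by rewrite mulr_ge0 //; lra.
suff /(_ (u, v)) : forall uv : V * V, reach H uv.1 uv.2 (t * (2 + 12 * e) * rdist G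
  uv.1 uv.2) by [].
apply: (@fin_lt_ind _ _ (fun uv => rdist G uv.1 uv.2)) => -[{}u {}v] /= IH.
have {}IH x y : rdist G x y < rdist G u v -> reach H x y (t * (2 + 12 * e) * rdist
  G x y).
  by move=> xy; apply: (IH (x, y)).
have [->|uv] := eqVneq u v; first by rewrite rdistxx mulr0; apply: reach_refl.
have [x ux dx] := rdist_step (cG u v) uv; have wux := adj_wt_gt0 ux.
have wE : rdist G u x = wt G [set u; x]%SET.
  apply/eqP; rewrite eq_le rdist_adj //= -(lerD2r (rdist G x v)) -dx.
  exact: rdist_triangle.
(* If the first edge stops short of [v], both pieces of the shortest path are strictly shorter and
   induction applies to each. *)
have [xv|xv] := eqVneq x v; last first.
  have xv0 : 0 < rdist G x v.
    have [y xy ->] := rdist_step (cG x v) xv.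
    by rewrite ltr_pwDl ?adj_wt_gt0 ?rdist_ge0.
  rewrite dx -wE mulrDr; apply: (@reach_trans _ _ _ _ x); apply: IH; lra.
rewrite {x}xv in ux wux wE dx *.
have d0 : 0 < rdist G u v by rewrite wE.
have [u' [v' [uu' vv' uv']]] := edgeH u v ux (esym wE).
have ed : e * rdist G u v < rdist G u v by rewrite gtr_pMl //; lra.
have hu := IH u u' (le_lt_trans uu' ed).
have hv := reach_sym (IH v v' (le_lt_trans vv' ed)).
apply: reach_le (reach_trans hu (reach_trans uv' hv)).
have := ler_wpM2l k0 uu'; have := ler_wpM2l k0 vv'.
set d := rdist G u v in d0 *; set du := rdist G u u'; set dv := rdist G v v'.
move=> le1 le2.
(* The three pieces cost at most [t (2 + 10 e + 24 e^2) d], which fits in [t (2 + 12 e) d] since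
   [12 e <= 1]. *)
have e2 : 0 <= 1 - 12 * e by lra.
have : 0 <= t * d * e * (1 - 12 * e) by rewrite !mulr_ge0 ?(ltW d0) ?(ltW e0).
lra.
Qed.

(** The support contains a partition, and its clusters have nonnegative diameter. *)
Lemma decomposable_t_ge0 t delta : (0 < #|V|)%N -> strongly_decomposable t delta G ->
  0 <= t.
Proof.
case/card_gt0P=> x _ /(_ 1 ltr01)[D [[Dge0 sumD partD] diamD _]].
have [P DP] : exists P, D P != 0.
  apply: contrapT => noP; move/eqP: sumD; rewrite big1 ?(eq_sym 0) ?oner_eq0 // => P _.
  by apply/eqP; apply: contraT => DP; case: noP; exists P.
have /and3P[/eqP covP _ _] := partD _ DP.
have := diamD P (finset.pblock P x) DP; rewrite pblock_mem ?covP ?finset.in_setT //.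
move=> /(_ isT); rewrite mulr1 -lee_fin; apply: le_trans.
exact: bigmax_ge_id.
Qed.

(** [delta] bounds from below the probability of an event for the pair [x], [x]. *)
Lemma decomposable_delta_le1 t delta : (0 < #|V|)%N -> strongly_decomposable t
  delta G ->
  delta <= 1.
Proof.
case/card_gt0P=> x _ /(_ 1 ltr01)[D [[Dge0 sumD partD] _ /(_ x x)]] le.
apply: le_trans (le _) _.
  by apply/reach_dist/reach_refl.
rewrite -sumD [leRHS](bigID (fun P => x \in finset.pblock P x)) /= lerDl.
exact: sumr_ge0.
Qed.

(** Two distinct vertices form a separated set of two points. *)
Lemma rdist_le_mst u v : graph_connected G -> rdist G u v <= mst_weight G *+ 2.
Proof.
move=> cG; have [->|uv] := eqVneq u v.
  have := @separated_mst _ _ G finset.set0 0 cG; rewrite mul0rn rdistxx; apply.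
  by move=> x; rewrite inE.
have := @separated_mst _ _ G [set u; v]%SET (rdist G u v) cG.
rewrite cards2 uv; apply=> x y; rewrite !inE.
by case/orP=> /eqP-> /orP[]/eqP->; rewrite ?eqxx // rdist_sym.
Qed.

End Spanners.

(** * Assembly of the spanner from all scales *)

Theorem theorem3 (R : realType) :
  exists (C : R) (k : nat), 0 < C /\
  forall (V : finType) (G : wgraph R V) (t delta : R),
    graph_connected G ->
    0 < delta ->
    strongly_decomposable t delta G ->
  forall eps : R, 0 < eps -> eps < 1 ->
  exists H : wgraph R V,
    [/\ graph_spanner (t * (2 + eps)) G H,
        lightness G H
          <= C * eps^-1 ^+ k * (t / delta * log2 (#|V|%:R : R) ^+ 2)
      & (#|edges H|)%:R
          <= C * eps^-1 ^+ k *
             (#|V|%:R / delta * log2 (#|V|%:R : R)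
                * Num.max 1 (log2 (aspect_ratio G)))].
Proof.
(* Lightness collects 3 from the rounds, 2 from [1 + 3 * e <= 2], 26 from the scales, and 144 from
   [e = eps / 12] squared. The edge count needs only [108 / eps]. *)
exists (156 * 144), 2%N; split=> [|V G t delta cG d0 dec eps eps0 eps1];
  first by rewrite mulr_gt0.
(* For at most one vertex the logarithm is 0, so both bounds are 0 and the edgeless graph attains
   them. *)
have [n1|n1] := leqP #|V| 1.
  have log0 : log2 (#|V|%:R : R) = 0.
    rewrite /log2; suff -> : ln (#|V|%:R : R) = 0 by rewrite mul0r.
    by apply/eqP; rewrite eq_le ln_le0 ?ler1n // //=; case: #|V| n1 => [|[|]] // _;
      rewrite ?ln1 ?ln0.
  have noedge (F : {set {set V}}) : edges (restr G F) = finset.set0.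
    apply/finset.setP => e; rewrite !inE; apply/negP => /andP[/card_edge e2 _].
    by have := max_card (mem e); rewrite e2 => /leq_trans/(_ n1).
  exists (restr G finset.set0); split.
  - split; first exact: restr_subgraph.
    move=> u v; have -> : u = v.
      by apply/eqP; apply: contraLR n1 => uv; rewrite -ltnNge; apply/card_gt1P;
        exists u, v.
    have t0 : 0 <= t by apply: decomposable_t_ge0 dec; apply/card_gt0P; exists u.
    apply: (@le_trans _ _ 0%E); first exact/reach_dist/reach_refl.
    by rewrite mule_ge0 ?dist_ge0 // lee_fin mulr_ge0 //; lra.
  - by rewrite log0 expr0n mulr0 mulr0 /lightness /weight noedge big_set0 mul0r.
  - by rewrite log0 mulr0 mul0r mulr0 noedge cards0.
have n0 : (0 < #|V|)%N := ltnW n1.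
have t0 := decomposable_t_ge0 n0 dec; have d1 := decomposable_delta_le1 n0 dec.
have [m [small mle]] := rounds n1 d0 d1.
pose e := eps / 12; have e0 : 0 < e by rewrite divr_gt0.
have e12 : e <= 12^-1 by rewrite /e; lra.
have e1 : e <= 1 by apply: le_trans e12 _; lra.
pose M := mst_weight G; pose a := min_wt G; pose Lam := aspect_ratio G.
pose D i := a * (1 + e) ^+ i.
have [u0 [v0 [uv0 neq0]]] : exists u v, adj G u v /\ u != v.
  have [x [y [_ _ xy]]] := card_gt1P n1.
  by have [z xz _] := rdist_step (cG x y) xy; exists x, z; rewrite (adj_neq xz).
have a0 : 0 < a := min_wt_gt0 uv0.
have M0 : 0 < M.
  have := rdist_le_mst u0 v0 cG; have [z xz ->] := rdist_step (cG u0 v0) neq0.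
  have := adj_wt_gt0 xz; have := rdist_ge0 G z v0; rewrite -/M; lra.
have Lam1 : 1 <= Lam.
  by rewrite ler_pdivlMr // mul1r (le_trans (min_wt_le uv0) (max_wt_ge uv0)).
have [K [KLam Kle]] := number_of_scales Lam1 e0 e1.
have D0 i : 0 < D i by rewrite mulr_gt0 ?exprn_gt0 //; lra.
have /choice[N NP] : forall i, exists N, _ := fun i =>
  ex_net cG (ltW (mulr_gt0 e0 (D0 i))).
(* An edge at scale [i] is shorter than [(1 + e) * D i], and moving each end to the net adds at most
   [e * D i]. *)
pose W i := (1 + 3 * e) * D i; have W0 i : 0 < W i by rewrite mulr_gt0 //; lra.
pose s := [seq i <- index_iota 0 K | D i <= M *+ 2].
have [i _|F [FG aF bF QF]] := @union_restr _ _ G _ s (fun=> m * #|V|)%N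
  (fun i => m%:R * (t * W i * #|N i|%:R))
  (fun i u v r => [/\ u \in N i, v \in N i, rdist G u v <= W i &
    r = t * W i + t * W i]).
  have [F [FG aF bF QF]] := scale_forest (N i) cG d1 dec (W0 i) small.
  by exists F; split=> // u v r [uN vN uv ->]; apply: QF.
have wF : edges (restr G F) = F by apply/finset.setIidPr.
exists (restr G F); split.
- split; first exact: restr_subgraph.
  move=> u v; rewrite (rdistE (cG u v)) -EFinM; apply/reach_dist.
  have -> : eps = 12 * e by rewrite /e; lra.
  apply: stretch_induction => // {}u {}v uv wE; set w := rdist G u v in wE *.
  (* The [K] scales suffice since [(1 + e) ^+ K] exceeds the aspect ratio. *)
  have [||i iK [Dw wD]] := @scale_index R a (1 + e) w K.
  - by rewrite -wE min_wt_le.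
  - rewrite -wE; apply: le_lt_trans (max_wt_ge uv) _.
    by rewrite mulrC -ltr_pdivrMr.
  have [sepN /[dup]/(_ u)[u' u'N uu'] /(_ v)[v' v'N vv']] := NP i.
  have eDw : e * D i <= e * w by rewrite ler_pM2l.
  exists u', v'; split; [exact: le_trans uu' eDw | exact: le_trans vv' eDw |].
  apply: reach_le (QF i _ u' v' _ _); last split=> //.
  + have : t * W i <= t * ((1 + 3 * e) * w) by rewrite ler_wpM2l // ler_wpM2l //; lra.
    lra.
  + rewrite mem_filter mem_index_iota iK /= andbT.
    by apply: le_trans Dw _; apply: rdist_le_mst.
  + apply: le_trans (rdist_triangle u' u v' cG) _.
    apply: le_trans (lerD (lexx _) (rdist_triangle u v v' cG)) _.
    rewrite (rdist_sym u' u cG) -/w; move: wD; rewrite exprSr mulrA -/(D i) /W => wD.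
    lra.
- have cost : \sum_(i <- s) D i * #|N i|%:R <= 26 * M * log2 #|V|%:R / e ^+ 2.
    rewrite big_filter; apply: scale_sum_le => // i.
      by rewrite mulrC ler_wpM2r ?(ltW (D0 i)) // ler_nat max_card.
    move=> DM; have [sepN _] := NP i; have := separated_mst cG sepN.
    rewrite -(mulr_natr (e * D i)) -/M => le.
    (* The point missing from the predecessor costs [D i], and [e * D i <= 2 M]; this turns
       [2 M / e] into [4 M / e]. *)
    have le1 : D i * #|N i|%:R <= D i * #|N i|.-1%:R + D i.
      rewrite -[X in _ + X]mulr1 -mulrDr ler_pM2l // natr1 ler_nat leqSpred //.
    apply: le_trans le1 _; rewrite ler_pdivlMr // mulrDl.
    have : D i * e <= M *+ 2 by apply: le_trans DM; rewrite ler_piMr // ltW.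
    lra.
  rewrite /lightness -/M ler_pdivrMr //.
  have -> : weight (restr G F) = \sum_(f in F) wt G f by rewrite /weight wF.
  apply: le_trans bF _.
  have -> : \sum_(i <- s) m%:R * (t * W i * #|N i|%:R) =
      m%:R * t * (1 + 3 * e) * \sum_(i <- s) D i * #|N i|%:R.
    by rewrite mulr_sumr; apply: eq_bigr => i _; rewrite /W; ring.
  have c0 : 0 <= m%:R * t * (1 + 3 * e) by rewrite !mulr_ge0 //; lra.
  apply: le_trans (ler_wpM2l c0 cost) _.
  have l0 : 0 <= log2 (#|V|%:R : R) by apply: le_trans (log2_ge1 R n1).
  have c1 : m%:R * t * (1 + 3 * e) <= 3 * (log2 #|V|%:R / delta) * t * 2.
    by apply: ler_pM; [exact: mulr_ge0 | lra | exact: ler_wpM2r | lra].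
  have B0 : 0 <= 26 * M * log2 #|V|%:R / e ^+ 2.
    apply: divr_ge0; last exact/exprn_ge0/ltW.
    by do 2!apply: mulr_ge0 => //; apply: ltW.
  apply: le_trans (ler_wpM2r B0 c1) _.
  rewrite le_eqVlt; apply/orP; left; apply/eqP; rewrite /e; field.
  by rewrite !gt_eqF.
- rewrite wF.
  have : (#|F|)%:R <= K%:R * (m%:R * #|V|%:R) :> R.
    rewrite -!natrM ler_nat; apply: leq_trans aF _.
    rewrite big_const_seq count_predT iter_addn_0 mulnC leq_mul2r.
    rewrite [X in _ || X](leq_trans (size_subseq (filter_subseq _ _))) ?orbT //.
    by rewrite size_iota subn0.
  move/le_trans; apply.
  have l0 : 0 <= log2 (#|V|%:R : R) by apply: le_trans (log2_ge1 R n1).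
  set x := Num.max _ _ in Kle *.
  have x0 : 0 <= x by apply: le_trans ler01 _; rewrite le_max lexx.
  apply: (@le_trans _ _ (3 / e * x * (3 * (log2 #|V|%:R / delta) * #|V|%:R))).
    by apply: ler_pM; rewrite ?mulr_ge0 ?ler_wpM2r.
  rewrite -subr_ge0 (_ : _ - _ =
    (156 * 144 - 108 * eps) * (x * (log2 #|V|%:R / delta) * #|V|%:R) / eps ^+ 2).
    apply: divr_ge0; last exact/exprn_ge0/ltW.
    apply: mulr_ge0; first lra.
    by do 2!apply: mulr_ge0 => //; apply: divr_ge0 => //; apply: ltW.
  by rewrite /e; field; rewrite !gt_eqF.
Qed.
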